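(* For any positive integer $n$ and any ring $R$, $MC_n(J(R))=J(MC_n(R))$.
   Context: All rings are associative with $1$. $J(R)$ denotes the Jacobson radical of $R$, the intersection of all maximal left ideals of $R$. $M_m(R)$ is the ring of $m\times m$ matrices over $R$. Identify $M_n(M_{n^k}(R))$ with $M_{n^{k+1}}(R)$ via block matrices. The $n$-matricial closure $MC_n(R)$ is the direct limit of the rings $M_{n^k}(R)$, $k\in\mathbb{N}=\{0,1,2,\dots\}$ (with $M_{n^0}(R)=R$), along the injective ring morphisms $M_{n^k}(R)\to M_{n^{k+1}}(R)$ sending $A$ to the block diagonal matrix with $n$ diagonal blocks equal to $A$; the canonical (injective) morphisms are $i^n_k:M_{n^k}(R)\to MC_n(R)$. For an ideal $I$ of $R$, $M_{n^k}(I)$ is the set of matrices in $M_{n^k}(R)$ with entries in $I$, and $MC_n(I)$ is the direct limit of the $M_{n^k}(I)$ along the restricted connecting maps, viewed inside $MC_n(R)$, i.e. $MC_n(I)=\bigcup_{k\ge 0}i^n_k(M_{n^k}(I))$. *)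

(* Defs.v *)
From HB Require Import structures.
From mathcomp Require Import all_boot all_order all_algebra.
From mathcomp Require Import boolp classical_sets.

Set Implicit Arguments.
Unset Strict Implicit.
Unset Printing Implicit Defensive.

Import GRing.Theory.

Local Open Scope classical_set_scope.
Local Open Scope ring_scope.
Local Open Scope quotient_scope.

(* pzRingType is the structure of associative rings with 1, not assumed
   commutative and possibly zero. *)

Definition left_ideal (R : pzRingType) (I : set R) : Prop :=
  [/\ I 0,
      forall x y, I x -> I y -> I (x + y) &
      forall a x, I x -> I (a * x)].

Definition maximal_left_ideal (R : pzRingType) (M : set R) : Prop :=
  [/\ left_ideal M, M <> setT &
      forall I : set R, left_ideal I -> M `<=` I -> I = M \/ I = setT].

(* In the zero ring the family is empty, and the intersection is the ring. *)
Definition jacobson (R : pzRingType) : set R :=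
  \bigcap_(M in [set M : set R | maximal_left_ideal M]) M.

Arguments jacobson R : clear implicits.

(* Direct limit of a sequence of rings S 0 -> S 1 -> S 2 -> ..., as the
   quotient of the disjoint union {k & S k} that identifies two elements when
   they have a common image further along the sequence. *)
Section DirectLimit.
Variables (S : nat -> pzRingType) (f : forall k, {rmorphism S k -> S k.+1}).

Local Notation T := {k : nat & S k}.

Definition dl_step (u : T) : T := Tagged (fun k => S k) (f _ (tagged u)).

Definition dl_rel : rel T :=
  fun u v => `[< exists d e, iter d dl_step u = iter e dl_step v >].

Lemma dl_relP u v :
  reflect (exists d e, iter d dl_step u = iter e dl_step v) (dl_rel u v).
Proof. exact: asboolP. Qed.

Lemma dl_rel_equiv : equiv_class_of dl_rel.
Proof.
split=> [u|u v|v u w].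
- by apply/dl_relP; exists 0%N, 0%N.
- by apply/dl_relP/dl_relP => -[d [e E]]; exists e, d.
move=> /dl_relP[d [e E]] /dl_relP[d' [e' E']].
apply/dl_relP; exists (d' + d)%N, (e + e')%N.
by rewrite iterD E -iterD addnC iterD E' -iterD.
Qed.

Canonical dl_rel_equiv_rel := EquivRelPack dl_rel_equiv.
Canonical dl_rel_encModRel := defaultEncModRel dl_rel.

Definition dirlim := {eq_quot dl_rel}.
HB.instance Definition _ : EqQuotient T dl_rel dirlim := EqQuotient.on dirlim.
HB.instance Definition _ := Choice.on dirlim.

Definition dl_in k (x : S k) : dirlim := \pi_dirlim (Tagged (fun k => S k) x).

Lemma dl_inP k l (x : S k) (y : S l) :
  dl_in x = dl_in y <->
  exists d e, iter d dl_step (Tagged (fun k => S k) x) =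
              iter e dl_step (Tagged (fun k => S k) y).
Proof.
split=> [/eqP|E]; first by rewrite /dl_in piE => /dl_relP.
by apply/eqP; rewrite /dl_in piE; apply/dl_relP.
Qed.

Lemma dl_in_step k (x : S k) : dl_in (f k x) = dl_in x.
Proof. by apply/dl_inP; exists 0%N, 1%N. Qed.

Lemma dl_in_surj (q : dirlim) : exists k (x : S k), q = dl_in x.
Proof. by elim/quotW: q => -[k x]; exists k, x. Qed.

Fixpoint dl_up d k (x : S k) : S (d + k) :=
  if d is d'.+1 then f _ (dl_up d' x) else x.

Lemma iter_dl_step d k (x : S k) :
  iter d dl_step (Tagged (fun k => S k) x) = Tagged (fun k => S k) (dl_up d x).
Proof. by elim: d => //= d ->. Qed.

Lemma dl_in_up d k (x : S k) : dl_in (dl_up d x) = dl_in x.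
Proof. by elim: d => //= d IH; rewrite dl_in_step. Qed.

Lemma dl_in_level k (x : S k) m : (k <= m)%N -> exists y : S m, dl_in x = dl_in y.
Proof.
move=> /subnK <-; exists (dl_up (m - k) x); by rewrite dl_in_up.
Qed.

Lemma dl_in_common3 (p q r : dirlim) :
  exists k (x y z : S k), [/\ p = dl_in x, q = dl_in y & r = dl_in z].
Proof.
have [a [x ->]] := dl_in_surj p; have [b [y ->]] := dl_in_surj q.
have [c [z ->]] := dl_in_surj r; pose m := maxn a (maxn b c).
have [|x' ->] := @dl_in_level _ x m; first by rewrite /m leq_maxl.
have [|y' ->] := @dl_in_level _ y m.
  by rewrite /m [maxn b c]maxnC maxnCA leq_max [maxn a b]maxnC leq_maxl orbT.
have [|z' ->] := @dl_in_level _ z m.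
  by rewrite /m !leq_max leqnn !orbT.
by exists m, x', y', z'.
Qed.

(* An operation is computed by moving both arguments up to a common level:
   the two tags below are l + k and k + l. *)
Definition dl_op2 (o : forall k, S k -> S k -> S k) (p q : dirlim) : dirlim :=
  let u := repr p in let v := repr q in
  let u' := iter (tag v) dl_step u in
  let v' := iter (tag u) dl_step v in
  dl_in (o _ (tagged u') (tagged_as u' v')).

Lemma dl_op2E (o : forall k, S k -> S k -> S k) :
    (forall k, {morph f k : x y / o k x y >-> o k.+1 x y}) ->
  forall k (x y : S k), dl_op2 o (dl_in x) (dl_in y) = dl_in (o k x y).
Proof.
move=> fo.
have upo d k (x y : S k) :
    dl_up d (o k x y) = o _ (dl_up d x) (dl_up d y).
  by elim: d => //= d ->; rewrite fo.
have key k l (x y : S k) (x' y' : S l) :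
    dl_in x = dl_in x' -> dl_in y = dl_in y' -> dl_in (o k x y) = dl_in (o l x' y').
  move=> /dl_inP[d [e Ex]] /dl_inP[d' [e' Ey]].
  have {}Ex : iter (d' + d) dl_step (Tagged (fun k => S k) x) =
              iter (d' + e) dl_step (Tagged (fun k => S k) x').
    by rewrite !iterD Ex.
  have {}Ey : iter (d' + d) dl_step (Tagged (fun k => S k) y) =
              iter (d + e') dl_step (Tagged (fun k => S k) y').
    by rewrite addnC !iterD Ey.
  move: Ex Ey; rewrite !iter_dl_step => Ex Ey.
  have Eee : (d' + e = d + e')%N.
    have := congr1 tag Ex; have := congr1 tag Ey; rewrite /= => -> /eqP.
    by rewrite eqn_add2r => /eqP.
  move: Ey; rewrite -Eee => Ey.
  rewrite -(dl_in_up (d' + d) (o k x y)) -(dl_in_up (d' + e) (o l x' y')) !upo.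
  move: (dl_up _ x) (dl_up _ y) (dl_up _ x') (dl_up _ y') Ex Ey.
  move: (d' + d + k)%N (d' + e + l)%N => a b z t z' t' Ez.
  have Eab : a = b by exact: (congr1 tag Ez).
  case: b / Eab z' t' Ez => z' t' /eqP + /eqP.
  by rewrite !eq_Tagged /= => /eqP -> /eqP ->.
move=> k x y; rewrite /dl_op2.
set u := repr (dl_in x); set v := repr (dl_in y); set u' := iter _ _ u; set v' := iter _ _ v.
have in_iter d w : dl_in (tagged (iter d dl_step w)) = \pi_dirlim w.
  by elim: d => [|d IH] /=; [case: w | rewrite dl_in_step].
have tagE d w : tag (iter d dl_step w) = (d + tag w)%N by elim: d => //= d ->.
have Euv : tag v' = tag u' by rewrite !tagE addnC.
apply: key; first by rewrite in_iter reprK.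
have -> : dl_in (tagged_as u' v') = dl_in (tagged v').
  case: (u') (v') Euv => a z [b t] /= Eba; case: a / Eba z => z.
  by rewrite tagged_asE.
by rewrite in_iter reprK.
Qed.

Definition dl_zero : dirlim := dl_in (0 : S 0).
Definition dl_one : dirlim := dl_in (1 : S 0).
Definition dl_add : dirlim -> dirlim -> dirlim := dl_op2 (fun k => +%R).
Definition dl_mul : dirlim -> dirlim -> dirlim := dl_op2 (fun k => *%R).
Definition dl_opp : dirlim -> dirlim := dl_op2 (fun k x _ => - x) ^~ dl_zero.

Lemma dl_in0 k : dl_in (0 : S k) = dl_zero.
Proof. by elim: k => // k <-; rewrite -(rmorph0 (f k)) dl_in_step. Qed.

Lemma dl_in1 k : dl_in (1 : S k) = dl_one.
Proof. by elim: k => // k <-; rewrite -(rmorph1 (f k)) dl_in_step. Qed.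

Lemma dl_inD k (x y : S k) : dl_in (x + y) = dl_add (dl_in x) (dl_in y).
Proof. by rewrite /dl_add dl_op2E // => j a b; rewrite rmorphD. Qed.

Lemma dl_inM k (x y : S k) : dl_in (x * y) = dl_mul (dl_in x) (dl_in y).
Proof. by rewrite /dl_mul dl_op2E // => j a b; rewrite rmorphM. Qed.

Lemma dl_inN k (x : S k) : dl_in (- x) = dl_opp (dl_in x).
Proof. by rewrite /dl_opp -(dl_in0 k) dl_op2E // => j a b; rewrite rmorphN. Qed.

Lemma dl_addA : associative dl_add.
Proof.
by move=> p q r; have [k [x [y [z [-> -> ->]]]]] := dl_in_common3 p q r;
  rewrite -!dl_inD addrA.
Qed.

Lemma dl_addC : commutative dl_add.
Proof.
by move=> p q; have [k [x [y [z [-> -> _]]]]] := dl_in_common3 p q q;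
  rewrite -!dl_inD addrC.
Qed.

Lemma dl_add0 : left_id dl_zero dl_add.
Proof.
by move=> p; have [k [x ->]] := dl_in_surj p; rewrite -(dl_in0 k) -dl_inD add0r.
Qed.

Lemma dl_addN : left_inverse dl_zero dl_opp dl_add.
Proof.
by move=> p; have [k [x ->]] := dl_in_surj p;
  rewrite -dl_inN -dl_inD addNr dl_in0.
Qed.

Lemma dl_mulA : associative dl_mul.
Proof.
by move=> p q r; have [k [x [y [z [-> -> ->]]]]] := dl_in_common3 p q r;
  rewrite -!dl_inM mulrA.
Qed.

Lemma dl_mul1 : left_id dl_one dl_mul.
Proof.
by move=> p; have [k [x ->]] := dl_in_surj p; rewrite -(dl_in1 k) -dl_inM mul1r.
Qed.

Lemma dl_mulr1 : right_id dl_one dl_mul.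
Proof.
by move=> p; have [k [x ->]] := dl_in_surj p; rewrite -(dl_in1 k) -dl_inM mulr1.
Qed.

Lemma dl_mulDl : left_distributive dl_mul dl_add.
Proof.
by move=> p q r; have [k [x [y [z [-> -> ->]]]]] := dl_in_common3 p q r;
  rewrite -!(dl_inD, dl_inM) mulrDl.
Qed.

Lemma dl_mulDr : right_distributive dl_mul dl_add.
Proof.
by move=> p q r; have [k [x [y [z [-> -> ->]]]]] := dl_in_common3 p q r;
  rewrite -!(dl_inD, dl_inM) mulrDr.
Qed.

HB.instance Definition _ :=
  GRing.isZmodule.Build dirlim dl_addA dl_addC dl_add0 dl_addN.
HB.instance Definition _ :=
  GRing.Zmodule_isPzRing.Build dirlim dl_mulA dl_mul1 dl_mulr1 dl_mulDl dl_mulDr.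

Lemma dl_in_is_zmod_morphism k : zmod_morphism (@dl_in k).
Proof. by move=> x y; rewrite dl_inD dl_inN. Qed.

Lemma dl_in_is_monoid_morphism k : monoid_morphism (@dl_in k).
Proof. by split=> [|x y]; [rewrite dl_in1 | rewrite dl_inM]. Qed.

HB.instance Definition _ k :=
  GRing.isZmodMorphism.Build (S k) dirlim (@dl_in k) (@dl_in_is_zmod_morphism k).
HB.instance Definition _ k :=
  GRing.isMonoidMorphism.Build (S k) dirlim (@dl_in k) (@dl_in_is_monoid_morphism k).

End DirectLimit.

Section MatricialClosure.
Variables (n : nat) (R : pzRingType).

Lemma sum_expn k : (\sum_(i < n) n ^ k)%N = (n ^ k.+1)%N.
Proof. by rewrite sum_nat_const card_ord expnS. Qed.

Definition block_diag k (A : 'M[R]_(n ^ k)) : 'M[R]_(n ^ k.+1) :=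
  castmx (sum_expn k, sum_expn k) (\mxdiag_(i < n) A).

Lemma block_diag_is_zmod_morphism k : zmod_morphism (@block_diag k).
Proof.
move=> A B; rewrite /block_diag mxdiagB.
by case: _ / (sum_expn k); rewrite !castmx_id.
Qed.

Lemma block_diag_is_monoid_morphism k : monoid_morphism (@block_diag k).
Proof.
split=> [|A B]; rewrite /block_diag.
  by rewrite mxdiagZ; case: _ / (sum_expn k); rewrite castmx_id.
have -> : \mxdiag_(i < n) (A * B) = \mxdiag_(i < n) A *m \mxdiag_(i < n) B.
  rewrite [X in _ *m X]/mxdiag mul_mxdiag_mxblock; apply/eq_mxblock => i j.
  by case: eqP => [e|_]; rewrite ?mulmx0 // !conform_mx_id.
by case: _ / (sum_expn k); rewrite !castmx_id.
Qed.

HB.instance Definition _ k :=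
  GRing.isZmodMorphism.Build 'M[R]_(n ^ k) 'M[R]_(n ^ k.+1) (@block_diag k)
    (@block_diag_is_zmod_morphism k).
HB.instance Definition _ k :=
  GRing.isMonoidMorphism.Build 'M[R]_(n ^ k) 'M[R]_(n ^ k.+1) (@block_diag k)
    (@block_diag_is_monoid_morphism k).

(* R itself enters as 'M[R]_(n ^ 0), the 1 x 1 matrices. *)
Definition MC : pzRingType :=
  @dirlim (fun k => 'M[R]_(n ^ k) : pzRingType)
          (fun k => @block_diag k : {rmorphism _ -> _}).

Definition MC_in k (A : 'M[R]_(n ^ k)) : MC :=
  @dl_in (fun k => 'M[R]_(n ^ k) : pzRingType)
         (fun k => @block_diag k : {rmorphism _ -> _}) k A.

HB.instance Definition _ k :=
  GRing.isZmodMorphism.Build 'M[R]_(n ^ k) MC (@MC_in k)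
    (@dl_in_is_zmod_morphism _ _ k).
HB.instance Definition _ k :=
  GRing.isMonoidMorphism.Build 'M[R]_(n ^ k) MC (@MC_in k)
    (@dl_in_is_monoid_morphism _ _ k).

Definition mx_set m (I : set R) : set 'M[R]_m := [set A | forall i j, I (A i j)].

Definition MC_set (I : set R) : set MC :=
  \bigcup_k (@MC_in k @` mx_set I).

End MatricialClosure.

Arguments MC_in n {R} k A.
Arguments MC_set n {R} I.

(* Main.v *)
(** An element [x] lies in the Jacobson radical iff every [1 - a * x] has a
    left inverse.  Since [1 - A *m B] is left invertible as soon as
    [1 - B *m A] is, matrices supported on one column reduce to scalars, and
    [J(M_m(R)) = M_m(J(R))].  The connecting maps preserve membership of the
    entries in [J(R)], which gives one inclusion; they also reflect left
    invertibility (take a diagonal block of a left inverse), which gives the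
    other. *)
Require Import Defs.
From mathcomp Require Import all_boot all_order all_algebra.
From mathcomp Require Import boolp classical_sets.

Set Implicit Arguments.
Unset Strict Implicit.
Unset Printing Implicit Defensive.

Import GRing.Theory.

Local Open Scope classical_set_scope.
Local Open Scope ring_scope.

Definition left_invertible (R : pzRingType) (x : R) : Prop :=
  exists y, y * x = 1.

Lemma left_ideal_full (R : pzRingType) (I : set R) :
  left_ideal I -> I 1 -> I = setT.
Proof.
by move=> [_ _ IM] I1; apply/seteqP; split=> // x _; rewrite -[x]mulr1; apply: IM.
Qed.

Lemma maximal_left_ideal_not1 (R : pzRingType) (M : set R) :
  maximal_left_ideal M -> ~ M 1.
Proof. by move=> [Mid MT _] /(left_ideal_full Mid). Qed.

(** Zorn's lemma, with properness stated as omitting [1], a condition that passes to unions of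
    chains. *)
Lemma exists_maximal_left_ideal (R : pzRingType) (I : set R) :
  left_ideal I -> ~ I 1 -> exists2 M, maximal_left_ideal M & I `<=` M.
Proof.
move=> Iid I1.
(* [set0] is admitted because [Zorn_bigcup] also ranges over the empty chain. *)
pose P (X : set R) := X = set0 \/ [/\ left_ideal X, I `<=` X & ~ X 1].
have [F FP Ftot|M [PM Mmax]] := @Zorn_bigcup _ P.
  have [[X [FX X0]]|nX] := pselect (exists X, F X /\ X !=set0); last first.
    left; apply/seteqP; split=> // x [X FX Xx].
    by apply: nX; exists X; split=> //; exists x.
  have FPn Y y : F Y -> Y y -> [/\ left_ideal Y, I `<=` Y & ~ Y 1].
    by move=> FY Yy; have [Y0|//] := FP _ FY; rewrite Y0 in Yy.
  have [x Xx] := X0; have [[Xz _ _] IX _] := FPn _ _ FX Xx.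
  right; split; first split.
  - by exists X.
  - move=> y z [Y FY Yy] [Z FZ Zz].
    have [[_ YD _] _ _] := FPn _ _ FY Yy.
    have [[_ ZD _] _ _] := FPn _ _ FZ Zz.
    have [YZ|ZY] := Ftot _ _ FY FZ.
      by exists Z => //; apply: ZD => //; apply: YZ.
    by exists Y => //; apply: YD => //; apply: ZY.
  - move=> a y [Y FY Yy]; exists Y => //.
    by have [[_ _ YM] _ _] := FPn _ _ FY Yy; apply: YM.
  - by move=> y Iy; exists X => //; apply: IX.
  - by move=> [Y FY Y1]; have [_ _] := FPn _ _ FY Y1.
have PI : P I by right; split.
have [M0|[Mid IM M1]] := PM.
  (* The empty set is not maximal for [P], since [I] contains [0] and satisfies [P]. *)
  exfalso; apply: (Mmax I) => //; split; first by rewrite M0.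
  by move=> sIM; have [I0 _ _] := Iid; have := sIM _ I0; rewrite M0.
exists M => //; split=> [//|MT|N Nid MN]; first by apply: M1; rewrite MT.
have [N1|N1] := pselect (N 1); first by right; apply: left_ideal_full.
left; apply: contrapT => NM; apply: (Mmax N); last first.
  by right; split=> // x /IM /MN.
by split=> // sNM; apply: NM; apply/seteqP.
Qed.

Lemma jacobson_left_ideal (R : pzRingType) : left_ideal (jacobson R).
Proof.
split=> [M [[]]//|x y Jx Jy M MM|a x Jx M MM].
  by have [[_ MD _] _ _] := MM; apply: MD; [apply: Jx | apply: Jy].
by have [[_ _ MZ] _ _] := MM; apply: MZ; apply: Jx.
Qed.

(** If [1 - a * x] has no left inverse, the left ideal it generates is proper, and a maximal [M]
    above it contains [x], hence [1]. Conversely, if a maximal [M] omits [x], then [M + R x] is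
    everything, so some [1 - b * x] lies in [M]; its left inverse puts [1] in [M]. *)
Lemma jacobsonP (R : pzRingType) (x : R) :
  jacobson R x <-> forall a, left_invertible (1 - a * x).
Proof.
split=> [Jx a|xJ M MM].
  apply: contrapT => nz; pose z := 1 - a * x.
  pose I : set R := [set u | exists b, u = b * z].
  have Iid : left_ideal I.
    split=> [|_ _ [b ->] [c ->]|c _ [b ->]]; first by exists 0; rewrite mul0r.
      by exists (b + c); rewrite mulrDl.
    by exists (c * b); rewrite mulrA.
  have [|M MM IM] := exists_maximal_left_ideal Iid.
    by move=> [b b1]; apply: nz; exists b.
  apply: (maximal_left_ideal_not1 MM); have [[_ MD MZ] _ _] := MM.
  rewrite -(subrK (a * x) 1); apply: MD; last by apply: MZ; apply: Jx.
  by apply: IM; exists 1; rewrite mul1r.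
apply: contrapT => nMx; have M1 := maximal_left_ideal_not1 MM.
have [[M0 MD MZ] MT Mmax] := MM.
pose I : set R := [set u | exists m b, M m /\ u = m + b * x].
have Iid : left_ideal I.
  split=> [|_ _ [m [b [Mm ->]]] [m' [b' [Mm' ->]]]|c _ [m [b [Mm ->]]]].
  - by exists 0, 0; rewrite mul0r addr0.
  - by exists (m + m'), (b + b'); split; [apply: MD | rewrite mulrDl addrACA].
  - by exists (c * m), (c * b); split; [apply: MZ | rewrite mulrDr mulrA].
have [m Mm|IM|IT] := Mmax I Iid.
- by exists m, 0; rewrite mul0r addr0.
- by apply: nMx; rewrite -IM; exists 0, 1; rewrite mul1r add0r.
have [m [b [Mm e1]]] : I 1 by rewrite IT.
have [y yE] := xJ b; apply: M1; rewrite -yE; apply: MZ.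
by rewrite e1 addrK.
Qed.

Lemma left_invertible_subM_swap (R : pzRingType) m p
    (A : 'M[R]_(m, p)) (B : 'M[R]_(p, m)) :
  left_invertible (1 - B *m A : 'M[R]_p) ->
  left_invertible (1 - A *m B : 'M[R]_m).
Proof.
(* Suggested by the formal geometric series: the powers of [A *m B] sum to [1 + A *m U *m B] when
   [U] is the sum of the powers of [B *m A]. *)
move=> [U UE]; exists (1 + A *m U *m B).
have UBA : U *m B *m A = U - 1.
  by rewrite -mulmxA -[1]UE -mulmxE mulmxBr mulmx1 subKr.
rewrite mulrBr mulr1 mulrDl mul1r -mulmxE !mulmxA -(mulmxA A U) -(mulmxA A _ A).
by rewrite UBA mulmxBr mulmx1 mulmxBl !mulmxA addrCA subrr addr0 addrK.
Qed.

Lemma left_invertible_scalar1 (R : pzRingType) (a : R) :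
  left_invertible (a%:M : 'M[R]_1) <-> left_invertible a.
Proof.
split=> [[U UE]|[u ua]]; last by exists u%:M; rewrite -mulmxE -scalar_mxM ua.
exists (U 0 0); move/matrixP/(_ 0 0): UE.
by rewrite [U]mx11_scalar -mulmxE -scalar_mxM !mxE eqxx !mulr1n.
Qed.

Lemma mx_set_jacobson (R : pzRingType) m :
  mx_set (jacobson R) = jacobson 'M[R]_m.
Proof.
have [J0 JD JM] := jacobson_left_ideal R.
have [K0 KD _] := jacobson_left_ideal 'M[R]_m.
apply/seteqP; split=> [A JA|A /jacobsonP JA i j].
  have -> : A = \sum_j col j A *m delta_mx 0 j.
    apply/matrixP=> i k; rewrite summxE (bigD1 k) //= big1 => [|j jk].
      by rewrite addr0 mxE big_ord1 !mxE !eqxx mulr1.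
    by rewrite mxE big_ord1 !mxE [k == j]eq_sym (negPf jk) andbF mulr0.
  apply: big_ind => // j _; apply/jacobsonP => B.
  (* Moving the row [delta_mx 0 j] to the left leaves a 1 x 1 matrix, whose entry is the sum over
     [k] of [B j k * A k j]. *)
  rewrite -mulmxE mulmxA; apply: left_invertible_subM_swap.
  rewrite -rowE [row _ _]mx11_scalar -[1]/(1%:M) -raddfB.
  apply/left_invertible_scalar1; rewrite -[X in 1 - X]mul1r.
  apply: (jacobsonP _).1; rewrite !mxE.
  by apply: big_ind => // k _; apply: JM; rewrite mxE.
(* The multiplier has [r] at position [(j, i)] and zeros elsewhere; swapping its column factor to
   the right of [A] leaves the 1 x 1 matrix [1 - r * A i j]. *)
apply/jacobsonP => r; have := JA (delta_mx j (0 : 'I_1) *m r%:M *m delta_mx 0 i).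
rewrite -!mulmxE -!mulmxA => /left_invertible_subM_swap.
rewrite -!mulmxA -colE -rowE [row i _]mx11_scalar -scalar_mxM.
by rewrite -[1]/(1%:M) -raddfB !mxE => /left_invertible_scalar1.
Qed.

Section DirectLimitRadical.
Variables (S : nat -> pzRingType) (f : forall k, {rmorphism S k -> S k.+1}).

Lemma dl_up_monoid_morphism d k : monoid_morphism (@dl_up S f d k).
Proof.
by elim: d => [|d [IH1 IHM]]; split=> //= [|x y]; rewrite ?IH1 ?IHM ?rmorph1 ?rmorphM.
Qed.

Lemma dl_in_eq1 k (x : S k) :
  dl_in f x = 1 -> exists d, dl_up f d x = 1.
Proof.
move=> x1; have /dl_inP[d [e]] : dl_in f x = dl_in f (1 : S k).
  by rewrite x1 dl_in1.
rewrite !iter_dl_step => E; exists d.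
(* Both elements start at level [k], so equal tags force equally many steps. *)
have de : d = e by apply/eqP; rewrite -(eqn_add2r k); apply/eqP/(congr1 tag E).
rewrite -de in E; move/eqP: E; rewrite eq_Tagged /= => /eqP ->.
by have [-> _] := dl_up_monoid_morphism d k.
Qed.

Lemma left_invertible_dl_up d k (x : S k) :
    (forall l (y : S l), left_invertible (f l y) -> left_invertible y) ->
  left_invertible (dl_up f d x) -> left_invertible x.
Proof. by move=> fV; elim: d => //= d IH /fV. Qed.

(** A left inverse in the limit comes from some level [l]. At level [l + k] its product with the
    image of [x] becomes [1] after [d] more steps, and reflection then descends through the [d] and
    the [l] steps. *)
Lemma left_invertible_dl_in k (x : S k) :
    (forall l (y : S l), left_invertible (f l y) -> left_invertible y) ->
  left_invertible (dl_in f x : dirlim f) -> left_invertible x.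
Proof.
move=> fV [q]; have [l [y ->]] := dl_in_surj q.
have [|z ->] := dl_in_level f y (m := l + k); first exact: leq_addr.
rewrite -(dl_in_up f l x) -rmorphM => /dl_in_eq1[d].
have [_ ->] := dl_up_monoid_morphism d (l + k) => zx1.
apply: (left_invertible_dl_up (d := l)) => //.
by apply: (left_invertible_dl_up (d := d)) => //; exists (dl_up f d z).
Qed.

(** Each multiplier [q] meets [x] at a common level, where the criterion applies; the left inverse
    found there maps to the limit. *)
Lemma jacobson_dl_in k (x : S k) :
    (forall l (y : S l), jacobson (S l) y -> jacobson (S l.+1) (f l y)) ->
  jacobson (S k) x -> jacobson (dirlim f) (dl_in f x).
Proof.
move=> fJ Jx; apply/jacobsonP => q; have [l [y ->]] := dl_in_surj q.
have [|z ->] := dl_in_level f y (m := l + k); first exact: leq_addr.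
have /jacobsonP/(_ z)[u uE] : jacobson _ (dl_up f l x).
  by elim: (l) => //= d; apply: fJ.
exists (dl_in f u); rewrite -(dl_in_up f l x) -(rmorph1 (dl_in f (k := l + k))).
by rewrite -rmorphM -rmorphB -rmorphM uE.
Qed.

Lemma jacobson_dl_in_inv k (x : S k) :
    (forall l (y : S l), left_invertible (f l y) -> left_invertible y) ->
  jacobson (dirlim f) (dl_in f x) -> jacobson (S k) x.
Proof.
move=> fV /jacobsonP Jx; apply/jacobsonP => a.
apply: left_invertible_dl_in => //.
by rewrite rmorphB rmorphM rmorph1; apply: Jx.
Qed.

End DirectLimitRadical.

Lemma mx_set_block_diag n (R : pzRingType) (I : set R) k (A : 'M[R]_(n ^ k)) :
  I 0 -> mx_set I A -> mx_set I (block_diag A).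
Proof.
move=> I0 IA i j; rewrite castmxE !mxE; case: eqP => _; last by rewrite mxE.
by rewrite conform_mx_id; apply: IA.
Qed.

Lemma left_invertible_block_diag n (R : pzRingType) k (A : 'M[R]_(n ^ k)) :
  (0 < n)%N -> left_invertible (block_diag A) -> left_invertible A.
Proof.
move=> n0 [C CA].
have [D DA] : exists D, D *m \mxdiag_(i < n) A = 1%:M.
  move: C CA; rewrite /block_diag -mulmxE -[1]/(1%:M).
  by case: _ / (sum_expn n k) => C; rewrite castmx_id => CA; exists C.
(* Positivity of [n] supplies a diagonal block. Right multiplication by the block diagonal matrix
   acts on each block of [D] separately, so comparing the blocks at [(i0, i0)] gives the
   identity. *)
pose i0 := Ordinal n0; exists (submxblock D i0 i0).
move: DA; rewrite -[D]submxblockK mul_mxblock_mxdiag -(mxdiagZ (p_ := fun=> (n ^ k)%N)).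
move/(congr1 (fun B => submxblock B i0 i0)).
by rewrite submxblock_diag mxblockK submxblockK.
Qed.

Theorem proposition26 (n : nat) (R : pzRingType) (n_gt0 : (0 < n)%N) :
  MC_set n (jacobson R) = jacobson (MC n R).
Proof.
have [J0 _ _] := jacobson_left_ideal R.
apply/seteqP; split=> [_ [k _ [A JA <-]]|q].
  apply: jacobson_dl_in => [l B|]; last by rewrite -mx_set_jacobson.
  by rewrite -!mx_set_jacobson; apply: mx_set_block_diag.
have [k [A ->]] := dl_in_surj q => Jq; exists k => //; exists A => //.
rewrite mx_set_jacobson; apply: jacobson_dl_in_inv Jq => l B.
exact: left_invertible_block_diag.
Qed.
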